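(* Let $(X,\tau)$ be a space that is strongly semi-symmetric, weak semi-$R_0$, and satisfies the condition $\mathcal{B}=\mathcal{B}'$. Then the following are equivalent: (1) $(X,\tau)$ is semi-$T_0$; (2) $(X,\tau)$ is semi-$T_1$; (3) $(X,\tau)$ is semi-$T_\omega$; (4) $(X,\tau)$ is semi-$T_{\frac{5\omega}{8}}$; (5) $(X,\tau)$ is semi-$T_{\frac{3\omega}{8}}$; (6) $(X,\tau)$ is semi-$T_{\frac{\omega}{4}}$.
   Context: Inclusions $\subset$ are not necessarily strict. A space (Alexandroff $\sigma$-space) $(X,\tau)$ is a nonempty set $X$ with a family $\mathcal{F}$ of subsets, called closed sets, that contains $\emptyset$ and $X$ and is closed under countable intersections and finite unions; $\tau$ is the family of complements of closed sets, called open sets. The closure $\overline{A}$ of $A\subset X$ is the intersection of all closed sets containing $A$ (it need not be closed). A set $A$ is semi-open if there is an open set $G$ with $G\subset A\subset\overline{G}$; it is semi-closed if $X-A$ is semi-open. The semi-closure $\overline{A}_s$ is the intersection of all semi-closed sets containing $A$ (it need not be semi-closed). The semi-kernel $sA_\tau^\wedge$ is the intersection of all semi-open sets containing $A$. $A$ is an $s\wedge_\tau$-set if $A=sA_\tau^\wedge$. $A$ is $s\lambda^*$-closed if $A=K\cap\overline{P}_s$ for some $s\wedge_\tau$-set $K$ and some $P\subset X$. $A$ is $sg^*$-closed if there is a semi-closed set $F\supset A$ such that $F\subset O$ for every semi-open set $O\supset A$. For $E\subset X$, the $sg^*$-closure $\overline{E_s^*}$ is the intersection of all $sg^*$-closed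 sets containing $E$. $\mathcal{B}=\{A\subset X: \overline{(X-A)}_s \text{ is semi-closed}\}$ and $\mathcal{B}'=\{A\subset X:\overline{(X-A)_s^*}\text{ is } sg^*\text{-closed}\}$. $(X,\tau)$ is: strongly semi-symmetric if every singleton is $sg^*$-closed; weak semi-$R_0$ if every $s\lambda^*$-closed singleton is an $s\wedge_\tau$-set; semi-$T_0$ if for any two distinct points there is a semi-open set containing one of them but not the other; semi-$T_1$ if for any distinct $x,y$ there are semi-open sets $U,V$ with $x\in U$, $y\notin U$, $y\in V$, $x\notin V$; semi-$T_\omega$ if every $sg^*$-closed set is semi-closed; semi-$T_{\frac{\omega}{4}}$ (respectively semi-$T_{\frac{3\omega}{8}}$, semi-$T_{\frac{5\omega}{8}}$) if for every finite (respectively countable, arbitrary) subset $P$ of $X$ and every $y\in X-P$ there is a set $A_y\supset P$ with $y\notin A_y$ such that $A_y$ is either semi-open or semi-closed. *)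

(* Defs.v *)
From mathcomp Require Import all_boot.
From mathcomp Require Import boolp classical_sets functions cardinality.

Set Implicit Arguments.
Unset Strict Implicit.
Unset Printing Implicit Defensive.

Local Open Scope classical_set_scope.

(* An Alexandroff sigma-space. Intersections indexed by nat cover all nonempty
   countable families (repeat a member), and setT is the empty intersection. *)
Record sigma_space (X : Type) := SigmaSpace {
  closed_set : set (set X);
  space_nonempty : [set: X] !=set0;
  closed_set0 : closed_set set0;
  closed_setT : closed_set setT;
  closed_bigcap : forall F : nat -> set X,
    (forall n, closed_set (F n)) -> closed_set (\bigcap_n F n);
  closed_setU : forall A B : set X,
    closed_set A -> closed_set B -> closed_set (A `|` B)
}.

Section SigmaSpace.
Variables (X : Type) (tau : sigma_space X).
Implicit Types A P E : set X.

Definition open_set A := closed_set tau (~` A).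

(* [smallest C A] is the intersection of all members of C that contain A; it
   need not itself belong to C. *)
Definition closure A := smallest (closed_set tau) A.

Definition semi_open A :=
  exists G : set X, [/\ open_set G, G `<=` A & A `<=` closure G].

Definition semi_closed A := semi_open (~` A).

Definition semi_closure A := smallest semi_closed A.

Definition semi_kernel A := smallest semi_open A.

Definition swedge_set A := A = semi_kernel A.

Definition slambda_star_closed A :=
  exists K P : set X, swedge_set K /\ A = K `&` semi_closure P.

Definition sg_star_closed A :=
  exists F : set X, [/\ semi_closed F, A `<=` F &
    forall O : set X, semi_open O -> A `<=` O -> F `<=` O].

Definition sg_star_closure E := smallest sg_star_closed E.

Definition family_B : set (set X) :=
  [set A | semi_closed (semi_closure (~` A))].

Definition family_B' : set (set X) :=
  [set A | sg_star_closed (sg_star_closure (~` A))].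

Definition strongly_semi_symmetric := forall x : X, sg_star_closed [set x].

Definition weak_semi_R0 :=
  forall x : X, slambda_star_closed [set x] -> swedge_set [set x].

Definition semi_T0 := forall x y : X, x <> y ->
  exists2 U : set X, semi_open U & (U x /\ ~ U y) \/ (U y /\ ~ U x).

Definition semi_T1 := forall x y : X, x <> y ->
  exists U V : set X,
    [/\ semi_open U, semi_open V, U x /\ ~ U y & V y /\ ~ V x].

Definition semi_Tomega := forall A, sg_star_closed A -> semi_closed A.

Definition semi_separated_from_points P := forall y : X, ~ P y ->
  exists A : set X, [/\ P `<=` A, ~ A y & semi_open A \/ semi_closed A].

Definition semi_Tomega_4 :=
  forall P, finite_set P -> semi_separated_from_points P.

(* [countable] includes the finite sets. *)
Definition semi_T3omega_8 :=
  forall P, countable P -> semi_separated_from_points P.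

Definition semi_T5omega_8 := forall P, semi_separated_from_points P.

End SigmaSpace.

(* Main.v *)
(* Strong semi-symmetry does all the work: it gives a semi-closed set between
   [set x] and its semi-kernel. Under semi-T1 the semi-kernel of a point is the
   point itself, so points are semi-closed; then every set is an intersection
   of semi-open sets [~` [set y]], hence equals its own semi-kernel, and an
   sg*-closed set, having a semi-closed set between it and its semi-kernel, is
   semi-closed. *)
Require Import Defs.
From mathcomp Require Import all_boot.
From mathcomp Require Import boolp classical_sets functions cardinality.

Local Open Scope classical_set_scope.

Lemma semi_T0_T1 {X : Type} (tau : sigma_space X) :
  strongly_semi_symmetric tau -> semi_T0 tau -> semi_T1 tau.
Proof.
move=> hsym T0.
have sep x y U : semi_open tau U -> U x -> ~ U y ->
    exists V, [/\ semi_open tau V, V y & ~ V x].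
  move=> oU Ux nUy; have [F [cF xF FU]] := hsym x.
  (* [F] lies inside every semi-open set around [x], in particular inside [U], so it misses [y]:
     one-sided separation can be reversed. *)
  exists (~` F); split=> //.
  - by apply: contra_not nUy; apply: (FU U) => // z ->.
  - by apply; exact: xF.
move=> x y xy; have [U oU [[Ux nUy]|[Uy nUx]]] := T0 _ _ xy.
- by have [V [oV Vy nVx]] := sep _ _ _ oU Ux nUy; exists U, V.
- by have [V [oV Vx nVy]] := sep _ _ _ oU Uy nUx; exists V, U.
Qed.

Lemma semi_T1_semi_closed1 {X : Type} (tau : sigma_space X) (x : X) :
  strongly_semi_symmetric tau -> semi_T1 tau -> semi_closed tau [set x].
Proof.
move=> hsym T1; have [F [cF xF FO]] := hsym x.
suff -> : [set x] = F by [].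
apply/seteqP; split=> // y Fy; apply: contrapT => yx.
have [U [_ [oU _ [Ux nUy] _]]] := T1 x y (fun e => yx (esym e)).
by apply: nUy; apply: FO Fy => // z ->.
Qed.

Lemma semi_T1_Tomega {X : Type} (tau : sigma_space X) :
  strongly_semi_symmetric tau -> semi_T1 tau -> semi_Tomega tau.
Proof.
move=> hsym T1 A [F [cF AF FO]].
suff -> : A = F by [].
apply/seteqP; split=> // y Fy; apply: contrapT => nAy.
(* Testing [F] against the complement of the semi-closed point [y] gives [y <> y]. *)
apply: (FO (~` [set y]) _ _ y Fy erefl).
- exact: semi_T1_semi_closed1.
- by move=> z Az zy; apply: nAy; rewrite -zy.
Qed.

Lemma semi_Tomega_T5omega_8 {X : Type} (tau : sigma_space X) :
  strongly_semi_symmetric tau -> semi_Tomega tau -> semi_T5omega_8 tau.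
Proof.
(* The largest set avoiding [y] serves every [P]; it is semi-open because [[set y]] is sg*-closed,
   hence semi-closed. *)
move=> hsym Tw P y nPy; exists (~` [set y]); split.
- by move=> z Pz zy; apply: nPy; rewrite -zy.
- by apply.
- by left; apply: Tw; exact: hsym.
Qed.

Lemma semi_Tomega_4_T0 {X : Type} (tau : sigma_space X) :
  semi_Tomega_4 tau -> semi_T0 tau.
Proof.
move=> T4 x y xy.
have [A [xA nAy [oA|cA]]] := T4 _ (finite_set1 x) y (fun e => xy (esym e)).
- by exists A => //; left; split=> //; exact: xA.
- by exists (~` A) => //; right; split=> //; apply; exact: xA.
Qed.

Theorem theorem5p30 (X : Type) (tau : sigma_space X)
    (hsym : strongly_semi_symmetric tau)
    (hR0 : weak_semi_R0 tau)
    (hB : family_B tau = family_B' tau) :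
  [<-> semi_T0 tau;
       semi_T1 tau;
       semi_Tomega tau;
       semi_T5omega_8 tau;
       semi_T3omega_8 tau;
       semi_Tomega_4 tau].
Proof.
tfae.
- exact: semi_T0_T1.
- exact: semi_T1_Tomega.
- exact: semi_Tomega_T5omega_8.
- by move=> T P _; exact: T.
- by move=> T P /finite_set_countable; exact: T.
- exact: semi_Tomega_4_T0.
Qed.
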